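(* Let $X$ be a set with at least two elements. Then every connected component of the free quandle $\operatorname{FQ}(X)$ on $X$ has infinite diameter with respect to the rack metric. Consequently, every connected component of the free rack on $X$ also has infinite diameter with respect to the rack metric.
   Context: A rack is a non-empty set $Q$ with a binary operation $\triangleright$ such that for every $x\in Q$ the map $\psi_x(y)=x\triangleright y$ is a bijection of $Q$, and $x\triangleright(y\triangleright z)=(x\triangleright y)\triangleright(x\triangleright z)$ for all $x,y,z$. It is a quandle if moreover $x\triangleright x=x$ for all $x$. The connected components are the orbits of the group generated by all $\psi_x$. The rack metric on a connected component is $d(x,y)=\min\{n\in\mathbb N\mid y=(\psi_{x_1}^{\pm1}\circ\dots\circ\psi_{x_n}^{\pm1})(x)\text{ for some }x_i\in Q\}$ ($n=0$ allowed). The free quandle (resp. free rack) on a set $X$ is the free object on $X$ in the category of quandles (resp. racks). *)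

(* Defs.v *)
From HB Require Import structures.
From mathcomp Require Import all_boot.
From mathcomp Require Import boolp classical_sets.

Set Implicit Arguments.
Unset Strict Implicit.
Unset Printing Implicit Defensive.

Local Open Scope classical_set_scope.

Declare Scope rack_scope.
Delimit Scope rack_scope with rack.
Reserved Notation "x |> y" (at level 40, left associativity).

HB.mixin Record isRack (Q : Type) := {
  rack_op : Q -> Q -> Q;
  rack_inhabited : inhabited Q;
  rack_op_bij : forall x, bijective (rack_op x);
  rack_opD : forall x y z,
    rack_op x (rack_op y z) = rack_op (rack_op x y) (rack_op x z)
}.

#[short(type="rackType")]
HB.structure Definition Rack := { Q of isRack Q }.

Notation "x |> y" := (rack_op x y) : rack_scope.
Local Open Scope rack_scope.

HB.mixin Record isQuandle Q of Rack Q := {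
  quandle_idem : forall x : Q, x |> x = x
}.

#[short(type="quandleType")]
HB.structure Definition Quandle := { Q of isQuandle Q & Rack Q }.

Section RackMetric.
Variable Q : rackType.
Implicit Types (x y : Q) (C : set Q).

Definition psi x : Q -> Q := rack_op x.

Lemma psi_inv_exists x : exists g : Q -> Q, cancel (psi x) g /\ cancel g (psi x).
Proof. by case: (rack_op_bij x) => g gK Kg; exists g. Qed.

Definition psi_inv x : Q -> Q := sval (cid (psi_inv_exists x)).

(* The group generated by all [psi x], as a set of self-maps of [Q]. *)
Inductive inner_group : set (Q -> Q) :=
| inner_id : inner_group id
| inner_psi x : inner_group (psi x)
| inner_comp f g : inner_group f -> inner_group g -> inner_group (f \o g)
| inner_inv f g : inner_group f -> cancel f g -> cancel g f -> inner_group g.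

Definition component x : set Q := [set g x | g in inner_group].

Definition connected_components : set (set Q) := range component.

Definition psi_pm (e : bool * Q) : Q -> Q :=
  if e.1 then psi e.2 else psi_inv e.2.

(* [(psi_{x_1}^{+-1} \o ... \o psi_{x_n}^{+-1}) x], the letters of [s] being
   the pairs (sign, x_i) listed in this order. *)
Definition psi_word (s : seq (bool * Q)) x : Q := foldr psi_pm x s.

Definition word_lengths x y : set nat :=
  [set n | exists2 s, size s = n & y = psi_word s x].

(* The minimum of [word_lengths x y]; the default value 0 is only taken when
   [x] and [y] lie in different components, where the metric is undefined. *)
Definition rack_dist x y : nat :=
  xget 0 [set n | word_lengths x y n /\
                  forall m, word_lengths x y m -> n <= m].

Definition infinite_diameter C : Prop :=
  forall N : nat, exists x y, [/\ C x, C y & N < rack_dist x y].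

End RackMetric.

Definition rack_morphism (Q R : rackType) (h : Q -> R) : Prop :=
  {morph h : x y / x |> y}.

Definition free_rack (X : Type) (F : rackType) (iota : X -> F) : Prop :=
  forall (Q : rackType) (f : X -> Q),
    exists! h : F -> Q, rack_morphism h /\ (forall a, h (iota a) = f a).

(* Quandles form a full subcategory of racks. *)
Definition free_quandle (X : Type) (F : quandleType) (iota : X -> F) : Prop :=
  forall (Q : quandleType) (f : X -> Q),
    exists! h : F -> Q, rack_morphism h /\ (forall a, h (iota a) = f a).

(* Main.v *)
Require Import Defs.
From HB Require Import structures.
From mathcomp Require Import all_boot.
From mathcomp Require Import boolp classical_sets.
From mathcomp Require Import ssralg ssrnum ssrint zify.

(** Rack morphisms do not increase distances, so distances in the free object
    are bounded below by distances in any quandle it maps to.  Let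
    [Q = {p_i | i in Z} + {q}], where [psi_q] sends [p_i] to [p_(i+1)] and every
    other translation is the identity: there a word of length [n] moves [p_0] at
    most to [p_n].  Given a generator [a], sending [a] to [p_0] and the other
    generators to [q] shows that [psi_b^n a] is at distance at least [n] from
    [a] for every generator [b] other than [a].  Mapping to a two-element
    trivial quandle shows that every component contains a generator. *)

Import GRing.Theory.
Local Open Scope rack_scope.

Definition trivial_bool : Type := bool.

Definition trivial_bool_op (x y : trivial_bool) : trivial_bool := y.

Lemma trivial_bool_op_bij x : bijective (trivial_bool_op x).
Proof. by exists id. Qed.

Lemma trivial_bool_opD x y z :
  trivial_bool_op x (trivial_bool_op y z) =
  trivial_bool_op (trivial_bool_op x y) (trivial_bool_op x z).
Proof. by []. Qed.

HB.instance Definition _ := isRack.Build trivial_bool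
  (inhabits (true : trivial_bool)) trivial_bool_op_bij trivial_bool_opD.

HB.instance Definition _ := isQuandle.Build trivial_bool (fun=> erefl).

(* [Some i] is the point [p_i] and [None] is [q]. *)
Definition shift_quandle : Type := option int.

Definition shift_op (x y : shift_quandle) : shift_quandle :=
  if x is None then omap (+%R 1%R) y else y.

Lemma shift_op_bij x : bijective (shift_op x).
Proof.
case: x => [i|]; first by exists id.
exists (omap (+%R (- 1)%R)) => -[i|] //=; congr Some; first exact: addKr.
exact: addNKr.
Qed.

Lemma shift_opD x y z :
  shift_op x (shift_op y z) = shift_op (shift_op x y) (shift_op x z).
Proof. by case: x y z => [?|] [?|] [?|]. Qed.

HB.instance Definition _ := isRack.Build shift_quandle
  (inhabits (None : shift_quandle)) shift_op_bij shift_opD.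

Lemma shift_op_idem x : shift_op x x = x.
Proof. by case: x. Qed.

HB.instance Definition _ := isQuandle.Build shift_quandle shift_op_idem.

Section RackTheory.
Variable Q : rackType.
Implicit Types x y : Q.

Lemma psi_invK x : cancel (psi_inv x) (psi x).
Proof. by rewrite /psi_inv; case: cid => g []. Qed.

Lemma psiK x : cancel (psi x) (psi_inv x).
Proof. by rewrite /psi_inv; case: cid => g []. Qed.

Lemma inner_psi_inv x : inner_group (psi_inv x).
Proof. exact: inner_inv (inner_psi x) (@psiK x) (@psi_invK x). Qed.

Lemma component_psi x y z : component (psi x y) z <-> component y z.
Proof.
split=> -[g Gg <-].
  by exists (g \o psi x) => //; apply: inner_comp Gg (inner_psi x).
exists (g \o psi_inv x); first exact: inner_comp Gg (inner_psi_inv x).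
by rewrite /= psiK.
Qed.

Lemma component_iter_psi n x y z :
  component x y -> component x (iter n (psi z) y).
Proof.
elim: n => //= n IHn /IHn[g Gg <-].
by exists (psi z \o g) => //; apply: inner_comp (inner_psi z) Gg.
Qed.

Lemma word_lengths_iter n x z : word_lengths x (iter n (psi z) x) n.
Proof.
exists (nseq n (true, z)); first by rewrite size_nseq.
by elim: n => //= n ->.
Qed.

(** One connecting word makes the set of lengths nonempty, so its minimum exists and the default
    value of [xget] is not taken. *)
Lemma rack_dist_word x y n :
  word_lengths x y n -> word_lengths x y (rack_dist x y).
Proof.
move=> xyn; have exn: exists n, `[< word_lengths x y n >].
  by exists n; apply/asboolP.
rewrite /rack_dist; case: xgetP => [_ _ []//|/(_ (ex_minn exn)) []].
case: ex_minnP => m /asboolP xym min_m; split=> // k xyk.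
exact/min_m/asboolP.
Qed.

(** A letter lying over some [Some k] fixes the index, and one lying over [None] changes it by one.
    The upper bound alone suffices below. *)
Lemma shift_word_le (h : Q -> shift_quandle) (hM : rack_morphism h) x s :
  h x = Some 0%R ->
  exists2 i : int, h (psi_word s x) = Some i & (i <= (size s)%:Z)%R.
Proof.
move=> hx; elim: s => [|[b z] s [i hi le_i]] /=; first by exists 0%R.
set y := psi_word s x in hi *; rewrite /psi_pm; case: b => /=.
  rewrite /psi hM hi; case: (h z) => [k|]; first by exists i => //; lia.
  by exists (1 + i)%R => //; lia.
(* For an inverse letter, apply [h] to [z |> psi_inv z y = y] and solve for the image of
   [psi_inv z y]. *)
have := hM z (psi_inv z y); rewrite -[z |> _]/(psi z _) psi_invK hi.
case: (h z) (h (psi_inv z y)) => [k|] [j|] //= [def_i]; exists j => //; lia.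
Qed.

End RackTheory.

Section FreeRack.
Variables (X : Type) (F : rackType) (iota : X -> F).
(* Common to the free rack and the free quandle: [F] is only tested against
   quandles. *)
Hypothesis F_free : forall (Q : quandleType) (f : X -> Q),
  exists! h : F -> Q, rack_morphism h /\ (forall a, h (iota a) = f a).

(** [P] is constant on components, so its indicator is a morphism to the trivial quandle. It agrees
    with the constant [true] on generators, hence everywhere. *)
Lemma component_generator x : exists a, component x (iota a).
Proof.
pose P (y : F) := exists a, component y (iota a).
have [h [_ h_uniq]] := F_free trivial_bool (fun=> true).
have h1: h = fun=> true by apply: h_uniq.
have: h = fun y => `[< P y >].
  apply: h_uniq; split=> [y z|a].
    apply: asbool_equiv_eq.
    by split=> -[a /component_psi Ca]; exists a => //; apply/(component_psi y).
  by apply/asboolP; exists a; exists id => //; apply: inner_id.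
by rewrite h1 => /(congr1 (@^~ x))/esym/asboolP.
Qed.

Lemma free_dist_iter a b n : a <> b ->
  n <= rack_dist (iota a) (iter n (psi (iota b)) (iota a)).
Proof.
move=> ab; pose f c : shift_quandle := if `[< c = a >] then Some 0%R else None.
have [h [[hM hf] _]] := F_free shift_quandle f.
have ha: h (iota a) = Some 0%R by rewrite hf /f asboolT.
have hb: h (iota b) = None by rewrite hf /f asboolF // => /esym.
have hn: h (iter n (psi (iota b)) (iota a)) = Some (Posz n).
  by elim: n => //= n IHn; rewrite /psi hM hb [h _]IHn; congr Some; lia.
(* Take [s] to be a shortest word; its image moves index 0 to [n]. *)
have [s <- def_s] := rack_dist_word _ _ _ _ (word_lengths_iter _ n (iota a) (iota b)).
have [i] := shift_word_le _ h hM _ s ha.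
by rewrite -def_s hn => -[<-].
Qed.

Lemma free_infinite_diameter (hX : exists a b : X, a <> b) (C : set F) :
  connected_components C -> infinite_diameter C.
Proof.
move=> [x _ <-] N; have [a Ca] := component_generator x.
(* The component dictates [a], but one of two distinct elements must differ from it. *)
have [b ab]: exists b, a <> b.
  case: hX => c [d cd]; have [ac|] := pselect (a = c); last by exists c.
  by exists d; rewrite ac.
exists (iota a), (iter N.+1 (psi (iota b)) (iota a)); split=> //.
  exact: component_iter_psi.
exact: free_dist_iter.
Qed.

End FreeRack.

Theorem corollary3p16 (X : Type) (hX : exists a b : X, a <> b) :
  (forall (FQ : quandleType) (iota : X -> FQ), free_quandle iota ->
     forall C : set FQ, connected_components C -> infinite_diameter C) /\
  (forall (FR : rackType) (iota : X -> FR), free_rack iota ->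
     forall C : set FR, connected_components C -> infinite_diameter C).
Proof.
(* Freeness among racks is used only for targets that are quandles. *)
by split=> F iota F_free C; apply: (free_infinite_diameter _ F iota).
Qed.
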